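(* If $\varphi$ is strictly convex, has a positive second derivative on its domain, $1/\varphi''$ is concave, and $\lim_{x\to\varphi'(\infty)^-}\psi^\star(x)=\infty$ (e.g. if $\varphi'(\infty)=\infty$), then $\operatorname{hgt}_{\psi^\star}(t)\le\dfrac{t^2}{8\varphi''(1)}$ for all $t\ge0$. Equivalently, for such $\varphi$, $$D_\varphi(\mu\|\nu)\ge\frac{\varphi''(1)}{2}\,\mathrm{TV}(\mu,\nu)^2\qquad\text{for all }\mu,\nu\in\mathcal M^1.$$
   Context: $(\Omega,\mathcal F)$ is a measurable space with $\{\emptyset,\Omega\}\subsetneq\mathcal F$; $\mathcal M^1$ is the set of probability measures on it. $\mathrm{TV}(\mu,\nu)=\sup\{|\int g\,d\mu-\int g\,d\nu|: g:\Omega\to[-1,1]\text{ measurable}\}$ (values in $[0,2]$). Standing assumptions on $\varphi$: $\varphi:\mathbb R\to[0,+\infty]$ is convex, lower semicontinuous, $\varphi(1)=0$, $\varphi(x)=+\infty$ for $x<0$, and $\operatorname{dom}\varphi=\{\varphi<\infty\}$ contains a neighborhood of $1$. Differentiability of $\varphi$ on its domain (and concavity of $1/\varphi''$) is understood on the interior of $\operatorname{dom}\varphi$. $\varphi'(\infty)=\lim_{x\to\infty}\varphi(x)/x$. Set $\psi(x)=\varphi(x+1)$, $\psi^\star(y)=\sup_x\{xy-\psi(x)\}$. For probability measures with Lebesgue decomposition $\mu=\mu_c+\mu_s$ ($\mu_c\ll\nu$, $\mu_s\perp\nu$), $D_\varphi(\mu\|\nu)=\int\varphi(\frac{d\mu_c}{d\nu})d\nu+\mu_s(\Omega)\varphi'(\infty)$,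 with $0\cdot\infty=0$. Height-for-width function: $\operatorname{hgt}_{\psi^\star}(w)=\inf\{h\in[0,\infty]:\text{the Lebesgue measure of }\{x\in\mathbb R:\psi^\star(x)\le h\}\text{ is at least }w\}$ for $w\ge0$. *)

(* Defs.v *)
From HB Require Import structures.
From mathcomp Require Import all_boot all_order all_algebra.
From mathcomp Require Import all_classical all_reals all_analysis.

Set Implicit Arguments.
Unset Strict Implicit.
Unset Printing Implicit Defensive.

Import Order.TTheory GRing.Theory Num.Theory.
Import numFieldNormedType.Exports.

Local Open Scope classical_set_scope.
Local Open Scope ring_scope.
Local Open Scope ereal_scope.
Local Open Scope charge_scope.

Section Generators.
Variable R : realType.
Implicit Types f phi : R -> \bar R.

Definition edom f : set R := [set x | f x < +oo].

Definition econvex f := forall (x y t : R), (0 <= t <= 1)%R ->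
  f (t * x + (1 - t) * y)%R <= t%:E * f x + (1 - t)%:E * f y.

Definition strict_econvex f := forall (x y t : R),
  edom f x -> edom f y -> x != y -> (0 < t < 1)%R ->
  f (t * x + (1 - t) * y)%R < t%:E * f x + (1 - t)%:E * f y.

Record is_generator phi : Prop := IsGenerator {
  generator_ge0 : forall x, 0 <= phi x ;
  generator_convex : econvex phi ;
  generator_lsc : lower_semicontinuous phi ;
  generator1 : phi 1%R = 0 ;
  generator_neg : forall x : R, (x < 0)%R -> phi x = +oo ;
  generator_nbhs1 : nbhs (1%R : R) (edom phi)
}.

Definition slope_infty phi : \bar R :=
  lim (phi x * (x^-1)%:E @[x --> +oo%R]).

(* psi(x) = phi(x + 1) *)
Definition shift1 phi : R -> \bar R := fun x => phi (x + 1)%R.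

Definition conjugate f : R -> \bar R :=
  fun y => ereal_sup (range (fun x : R => (x * y)%:E - f x)).

Definition psi_star phi : R -> \bar R := conjugate (shift1 phi).

(* x tends to c from below, with x real and c possibly infinite. *)
Definition left_of (c : \bar R) : set_system R :=
  fine @ within [set y | y < c] (nbhs c).

Lemma left_of_fin (c : R) : left_of c%:E = at_left c.
Proof.
apply/seteqP; split => A H.
  by apply: filterS (H : nbhs c _) => x + xc; apply; rewrite /= lte_fin.
apply: (filterS _ (H : nbhs c _)) => x + xc; apply; by rewrite -lte_fin.
Qed.

Lemma left_of_pinfty : left_of +oo = pinfty_nbhs R.
Proof.
apply/seteqP; split => A; rewrite /left_of /= /nbhs /= /within /=.
  move=> [M [Mr MA]]; exists M; split => // x Mx.
  by apply: (MA x%:E); rewrite ?lte_fin ?ltry.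
move=> [M [Mr MA]]; exists M; split => // -[x| |] //= Mx _.
by apply: MA; rewrite -lte_fin.
Qed.

(* The finite part of phi, which is phi itself on the interior of its domain,
   where derivatives of phi are taken. *)
Definition fpart phi : R -> R := fun x => fine (phi x).

Definition second phi : R -> R := ((fpart phi)^`(2))%classic.

Definition pos_second_derivative phi := forall x : R, (edom phi)° x ->
  [/\ derivable (fpart phi) x 1%R,
      derivable ((fpart phi)^`())%classic x 1%R &
      (0 < second phi x)%R].

Definition concave_on (D : set R) (g : R -> R) :=
  convex_function (D : set R^o) (fun x => (- g x)%R).

Definition height_for_width f (w : R) : \bar R :=
  ereal_inf [set h : \bar R | 0 <= h /\
    w%:E <= lebesgue_measure [set x : R | f x <= h]].

End Generators.

Section Divergences.
Context {d : measure_display} {T : measurableType d} {R : realType}.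
Implicit Types mu nu : {finite_measure set T -> \bar R}.

Definition mutually_singular (m1 m2 : set T -> \bar R) :=
  exists N, [/\ measurable N, m1 (~` N) = 0 & m2 N = 0].

Definition is_lebesgue_decomposition mu nu muc mus :=
  [/\ forall A, measurable A -> mu A = muc A + mus A,
      muc `<< nu & mutually_singular mus nu].

Lemma lebesgue_decomposition_exists mu nu :
  exists p : {finite_measure set T -> \bar R} * {finite_measure set T -> \bar R},
    is_lebesgue_decomposition mu nu p.1 p.2.
Proof.
pose S := [set x | exists A, [/\ measurable A, nu A = 0 & x = mu A]].
have mufin A : measurable A -> mu A \is a fin_num by move=> mA; exact: fin_num_measure.
have S0 : S !=set0 by exists (mu set0), set0; split => //; exact: measure0.
have Sfin : ereal_sup S \is a fin_num.
  rewrite ge0_fin_numE; last first.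
    by apply: ereal_sup_ubound; exists set0; split => //; rewrite measure0.
  apply: (@le_lt_trans _ _ (mu setT)); last by rewrite ltey_eq mufin.
  by apply: ge_ereal_sup => _ [A [mA _ ->]]; apply: le_measure; rewrite ?inE.
have H n : exists A, [/\ measurable A, nu A = 0 &
    ereal_sup S - (n.+1%:R^-1)%:E < mu A].
  have n0 : (0 < n.+1%:R^-1 :> R)%R by rewrite invr_gt0.
  by have [_ [A [mA A0 ->]] ?] := ub_ereal_sup_adherent n0 Sfin; exists A.
have {}H n := cid (H n).
pose A_ n := sval (H n).
have mA_ n : measurable (A_ n) by rewrite /A_; case: (H n) => ? [].
have A_0 n : nu (A_ n) = 0 by rewrite /A_; case: (H n) => ? [].
pose N := \bigcup_n A_ n.
have mN : measurable N by exact: bigcup_measurable.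
have negl B : measurable B -> nu B = 0 -> nu.-negligible B.
  by move=> mB B0; exists B; split.
have N0 : nu N = 0.
  apply: (proj1 (negligibleP nu mN)); apply: negligible_bigcup => k.
  exact: negl.
have SN : ereal_sup S <= mu N.
  apply/lee_addgt0Pr => e e0.
  have [n ne] : exists n, (n.+1%:R^-1 < e)%R.
    have [k _ Hk] := near_infty_natSinv_lt (PosNum e0).
    by exists k; apply: Hk => /=.
  apply: (@le_trans _ _ (mu (A_ n) + (n.+1%:R^-1)%:E)).
    by rewrite -leeBlDr //; rewrite /A_; case: (H n) => ? /= [_ _ /ltW].
  rewrite leeD ?lee_fin ?(ltW ne)//; apply: le_measure; rewrite ?inE//.
  exact: bigcup_sup.
have fN (B : set T) (mB : measurable B) : mu B < +oo by rewrite ltey_eq mufin.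
have mNc : measurable (~` N) by exact: measurableC.
exists ((mfrestr mNc (fN _ mNc) : {finite_measure set T -> \bar R}),
  (mfrestr mN (fN _ mN) : {finite_measure set T -> \bar R})); split => /=.
- move=> A mA; rewrite /mfrestr /mrestr -setDE.
  by rewrite (measureDI mu mA mN).
- apply/null_content_dominatesP => B mB B0; rewrite /mfrestr /mrestr -setDE.
  have mBN : measurable (B `\` N) by exact: measurableD.
  have : mu (N `|` (B `\` N)) <= mu N.
    apply: le_trans SN; apply: ereal_sup_ubound; exists (N `|` (B `\` N)).
    split => //; first exact: measurableU.
    apply: (proj1 (negligibleP nu (measurableU _ _ mN mBN))).
    apply: negligibleU; first exact: negl.
    by apply: negligibleS (negl _ mB B0) => x [].
  rewrite measureU//; last by rewrite setDE setICA setICr setI0.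
  move=> h; apply/eqP; rewrite eq_le measure_ge0 andbT.
  have : mu N + mu (B `\` N) <= mu N + 0 by rewrite adde0.
  by rewrite leeD2lE// mufin.
- exists N; split => //; last by rewrite /mfrestr /mrestr setICl measure0.
Qed.

Definition ac_part mu nu : {finite_measure set T -> \bar R} :=
  (sval (cid (lebesgue_decomposition_exists mu nu))).1.

Definition sing_part mu nu : {finite_measure set T -> \bar R} :=
  (sval (cid (lebesgue_decomposition_exists mu nu))).2.

Lemma ac_sing_partP mu nu :
  is_lebesgue_decomposition mu nu (ac_part mu nu) (sing_part mu nu).
Proof. exact: (svalP (cid (lebesgue_decomposition_exists mu nu))). Qed.

(* The Radon-Nikodym derivative of the library is finite everywhere, so [fine]
   only changes its type; in \bar R, 0 * +oo = 0. *)
Definition phi_divergence (phi : R -> \bar R) mu nu : \bar R :=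
  \int[nu]_x phi (fine (('d (charge_of_finite_measure (ac_part mu nu)) '/d nu) x))
  + sing_part mu nu setT * slope_infty phi.

(* The supremum is over a nonempty set bounded by mu setT + nu setT. *)
Definition TV_distance mu nu : R :=
  sup [set `| \int[mu]_x g x - \int[nu]_x g x |%R | g in
    [set g : T -> R | measurable_fun setT g /\ forall x, (-1 <= g x <= 1)%R]].

End Divergences.

(* Main.v *)
(* Write k = phi''(1) and u = x - 1. A supporting line at 1 of the concave function
   1/phi'' gives s with phi''(x) >= k / (1 + s u), hence phi''(x) >= 27 k / (3 + s u)^3
   by AM-GM; integrating twice from 1, phi(x) >= (3 k / 2) u^2 / (3 + s u). The tangents
   of this bound are the affine minorants
     phi(x) >= k a u - (k l^2 / 2) (1 + s u / 3)   for |a| <= l,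
   which extend to the endpoints of the domain by convexity. They say that psi_star is
   at most k l^2 / 2 on an interval of length 2 k l, which bounds the height with
   l = t / (2 k). Taking a = l g(omega), x = (dmu_c/dnu)(omega) for a test function g
   and integrating, the terms in s cancel because mu and nu have the same mass (the
   slope of the minorant also bounds phi'(oo), for the singular part), which leaves
     D_phi(mu || nu) >= k l (int g dmu - int g dnu) - k l^2 / 2;
   it remains to optimise over l and g. *)
Require Import Defs.
From HB Require Import structures.
From mathcomp Require Import all_boot all_order all_algebra.
From mathcomp Require Import all_classical all_reals all_analysis.
From mathcomp Require Import measurable_realfun.
From mathcomp Require Import ring lra.

Set Implicit Arguments.
Unset Strict Implicit.
Unset Printing Implicit Defensive.

Import Order.TTheory GRing.Theory Num.Theory.
Import numFieldNormedType.Exports.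

Local Open Scope classical_set_scope.
Local Open Scope ring_scope.

(** * Supporting lines, second-order comparison, and derivatives of the rational minorant *)

Section RealFunctions.
Context {R : realType}.
Implicit Types (D : set R) (f g : R -> R) (s k u x y : R).

Lemma concave_on_chord D g x y t : concave_on D g -> D x -> D y -> 0 <= t <= 1 ->
  t * g x + (1 - t) * g y <= g (t * x + (1 - t) * y).
Proof.
move=> cg Dx Dy /andP[t0 t1].
have := cg (Itv01 t0 t1) x y (mem_set Dx) (mem_set Dy).
rewrite !convRE /= /unstable.onem.
by rewrite [X in - g X <= _](_ : _ = t * x + (1 - t) * y)//; lra.
Qed.

(** The slope [c] is the supremum of the chord slopes to the right of [a]. Concavity puts every left
    chord slope above every right one, and [D] has points on both sides of [a], so this supremum is
    finite and lies below all left slopes. *)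
Lemma concave_on_supporting_line D g a : nbhs a D -> concave_on D g ->
  exists c, forall x, D x -> g x <= g a + c * (x - a).
Proof.
move=> Da cg; have aD : D a by exact: nbhs_singleton.
have chord y x : D y -> D x -> y < a -> a < x ->
    (g x - g a) / (x - a) <= (g a - g y) / (a - y).
  move=> Dy Dx ya ax; rewrite ler_pdivrMr ?subr_gt0// mulrAC ler_pdivlMr ?subr_gt0//.
  have xy : 0 < x - y by lra.
  have t01 : 0 <= (x - a) / (x - y) <= 1.
    by rewrite divr_ge0 ?ler_pdivrMr ?mul1r//=; lra.
  have := @concave_on_chord D g y x _ cg Dy Dx t01.
  have -> : 1 - (x - a) / (x - y) = (a - y) / (x - y) by field; lra.
  have -> : (x - a) / (x - y) * y + (a - y) / (x - y) * x = a by field; lra.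
  have -> : (x - a) / (x - y) * g y + (a - y) / (x - y) * g x =
    ((x - a) * g y + (a - y) * g x) / (x - y) by field; lra.
  by rewrite ler_pdivrMr//; lra.
have /nbhs_ballP[e /= e0 eD] := Da.
have e2 : 0 < e / 2 by rewrite divr_gt0.
have Dm : D (a - e / 2) by apply: eD; rewrite /ball/= opprB addrC subrK gtr0_norm//; lra.
have Dp : D (a + e / 2).
  by apply: eD; rewrite /ball/= opprD addNKr normrN gtr0_norm//; lra.
pose S := [set (g x - g a) / (x - a) | x in [set x | D x /\ a < x]].
have Sub y : D y -> y < a -> ubound S ((g a - g y) / (a - y)).
  by move=> Dy ya _ [x [Dx ax] <-]; exact: chord.
have S0 : S !=set0.
  exists ((g (a + e / 2) - g a) / (a + e / 2 - a)), (a + e / 2) => //.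
  by split => //; lra.
have Ssup : has_sup S by split => //; eexists; apply: (Sub _ Dm); lra.
exists (sup S) => x Dx; have [xa|ax|->] := ltgtP x a; last by lra.
  have : sup S <= (g a - g x) / (a - x) by apply: ge_sup => //; exact: Sub.
  by rewrite ler_pdivlMr; lra.
have : (g x - g a) / (x - a) <= sup S.
  by apply: ub_le_sup; [case: Ssup|exists x].
by rewrite ler_pdivrMr; lra.
Qed.

(** The order of [a] and [x] is left open so that both sides of 1 are treated at once. The sign
    clause records that [c] is on the same side of [a] as [x]. *)
Lemma MVT_between (f df : R -> R) a x :
  (forall y, Num.min a x <= y <= Num.max a x -> is_derive y 1 f (df y)) ->
  exists c, [/\ Num.min a x <= c <= Num.max a x, 0 <= (c - a) * (x - a) &
    f x - f a = df c * (x - a)].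
Proof.
have main u v : u <= v ->
    (forall y, u <= y <= v -> is_derive y 1 f (df y)) ->
    exists2 c, u <= c <= v & f v - f u = df c * (v - u).
  move=> uv dfu; have [||c] := @MVT_segment _ f df u v uv.
  - by move=> y; rewrite in_itv/= => /andP[/ltW uy /ltW yv]; apply: dfu; rewrite uy.
  - apply: derivable_within_continuous => y; rewrite in_itv/= => /dfu d.
    exact: ex_derive.
  - by rewrite in_itv/=; exists c.
have [ax|/ltW xa] := leP a x => dfu.
  have [c ac e] := main _ _ ax dfu; exists c; split=> //; nra.
have [c ac e] := main _ _ xa dfu; exists c; split=> //; first nra.
by rewrite -opprB e; lra.
Qed.

(** Two uses of the mean value theorem give f x = ddf b * (c - a) * (x - a), where the product of
    the last two factors is nonnegative. *)
Lemma ge0_second_derive (f df ddf : R -> R) a x :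
  (forall y, Num.min a x <= y <= Num.max a x ->
    [/\ is_derive y 1 f (df y), is_derive y 1 df (ddf y) & 0 <= ddf y]) ->
  f a = 0 -> df a = 0 -> 0 <= f x.
Proof.
move=> H fa dfa.
have [c [acx ca e]] :=
  @MVT_between f df a x (fun y h => let: And3 p _ _ := H y h in p).
have mono y : Num.min a c <= y <= Num.max a c -> Num.min a x <= y <= Num.max a x.
  move: acx; rewrite !minElt !maxElt.
  by case: (ltP a c); case: (ltP a x) => ? ? /andP[? ?] /andP[? ?]; apply/andP; split; lra.
have [b [abc _ e']] :=
  @MVT_between df ddf a c (fun y h => let: And3 _ p _ := H y (mono _ h) in p).
have [_ _ ddb] := H _ (mono _ abc).
move: e e'; rewrite fa dfa !subr0 => -> ->.
by rewrite -mulrA mulr_ge0.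
Qed.

Lemma is_derive_affineV s x : 3 + s * (x - 1) != 0 ->
  is_derive x 1 (fun y => (3 + s * (y - 1))^-1) (- s / (3 + s * (x - 1)) ^+ 2).
Proof.
move=> w0; have dw : is_derive x 1 (fun y => 3 + s * (y - 1)) s.
  by apply: is_derive_eq; rewrite ?scaler1 ?scaler0 /GRing.scale/=; ring.
apply: is_derive_eq (@is_deriveV _ (fun y => 3 + s * (y - 1)) _ _ _ w0 dw) _.
by rewrite /GRing.scale/= mulrC mulNr mulrN.
Qed.

Lemma is_derive_sqr_over_affine k s x : 3 + s * (x - 1) != 0 ->
  is_derive x 1 (fun y => 3 * k / 2 * ((y - 1) ^+ 2 / (3 + s * (y - 1))))
    (3 * k / 2 * ((6 * (x - 1) + s * (x - 1) ^+ 2) / (3 + s * (x - 1)) ^+ 2)).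
Proof.
move=> w0; have dV := is_derive_affineV w0.
have dq : is_derive x 1 (fun y => (y - 1) ^+ 2) (2 * (x - 1)).
  by apply: is_derive_eq; rewrite /GRing.scale/=; ring.
apply: is_derive_eq (is_deriveZ (3 * k / 2) (is_deriveM dq dV)) _.
by rewrite /GRing.scale/=; field.
Qed.

(** With u = x - 1, the numerator (6 + 2 s u)(3 + s u) - 2 s (6 u + s u^2) collapses to 18, which
    leaves a pure inverse cube. *)
Lemma is_derive2_sqr_over_affine k s x : 3 + s * (x - 1) != 0 ->
  is_derive x 1 (fun y => 3 * k / 2 *
      ((6 * (y - 1) + s * (y - 1) ^+ 2) / (3 + s * (y - 1)) ^+ 2))
    (27 * k / (3 + s * (x - 1)) ^+ 3).
Proof.
move=> w0; have dV := is_derive_affineV w0.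
have dq : is_derive x 1 (fun y => 6 * (y - 1) + s * (y - 1) ^+ 2) (6 + 2 * s * (x - 1)).
  by apply: is_derive_eq; rewrite /GRing.scale/=; ring.
rewrite (_ : (fun y => _) = (3 * k / 2) *:
  ((fun y => 6 * (y - 1) + s * (y - 1) ^+ 2) * (fun y => (3 + s * (y - 1))^-1) ^+ 2)); last first.
  by apply/funext => y; rewrite /= -exprVn.
apply: is_derive_eq (is_deriveZ (3 * k / 2) (is_deriveM dq (is_deriveX 2 dV))) _.
by rewrite /GRing.scale/= fctE/= expr1; field.
Qed.

End RealFunctions.

(** * Convexity of the domain and of its interior *)

Section ExtendedConvexity.
Context {R : realType}.
Implicit Types f : R -> \bar R.

Lemma edom_convex f x y t : econvex f -> edom f x -> edom f y -> 0 <= t <= 1 ->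
  edom f (t * x + (1 - t) * y).
Proof.
move=> cf fx fy t01; rewrite /edom/=; apply: le_lt_trans (cf _ _ _ t01) _.
by rewrite lte_add_pinfty// lte_mul_pinfty// lee_fin; lra.
Qed.

(** The homothety of centre [x] and ratio [t] maps a ball around [a] inside the domain onto a ball
    of radius [t * e], still inside the domain by convexity. *)
Lemma edom_interior_segment f a x t : econvex f -> (edom f)° a -> edom f x ->
  0 < t <= 1 -> (edom f)° (t * a + (1 - t) * x).
Proof.
move=> cf /nbhs_ballP[e /= e0 ae] fx /andP[t0 t1].
apply/nbhs_ballP; exists (t * e) => /=; first by rewrite mulr_gt0.
move=> z; rewrite /ball/= => az.
have -> : z = t * ((z - (1 - t) * x) / t) + (1 - t) * x by field; rewrite gt_eqF.
apply: edom_convex => //; last by lra.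
apply: ae; rewrite /ball/= -(ltr_pM2l t0) -{1}(gtr0_norm t0) -normrM.
rewrite [t * (_ - _)](_ : _ = t * a + (1 - t) * x - z)//.
by field; rewrite gt_eqF.
Qed.

End ExtendedConvexity.

(** * From a supporting line of 1/phi'' to a lower bound on phi'' *)

Lemma inv_affine_ge {R : realFieldType} (b d c u : R) : 0 < d -> 0 < b ->
  d^-1 <= b^-1 + c * u -> 0 < 1 + c * b * u /\ b / (1 + c * b * u) <= d.
Proof.
move=> d0 b0 h; have e : 1 + c * b * u = b * (b^-1 + c * u).
  by rewrite mulrDr mulfV ?gt_eqF//; ring.
have w0 : 0 < b^-1 + c * u by apply: lt_le_trans h; rewrite invr_gt0.
rewrite e invfM mulrA mulfV ?gt_eqF// mul1r mulr_gt0//; split=> //.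
by rewrite -[leRHS]invrK lef_pV2 ?posrE ?invr_gt0.
Qed.

Section GeneratorBounds.
Context {R : realType}.
Variable phi : R -> \bar R.
Hypothesis phi_gen : is_generator phi.
Hypothesis phi_second : pos_second_derivative phi.

Local Notation I := (edom phi)°.
Local Notation k := (second phi 1).

Lemma generator_interior1 : I 1.
Proof. exact: generator_nbhs1. Qed.

Lemma generator_fpartK x : edom phi x -> phi x = (fpart phi x)%:E.
Proof.
by move=> px; rewrite fineK// ge0_fin_numE//; exact: (generator_ge0 phi_gen).
Qed.

Lemma fpart_ge0 x : 0 <= fpart phi x.
Proof. by rewrite fine_ge0// (generator_ge0 phi_gen). Qed.

Lemma fpart1 : fpart phi 1 = 0.
Proof. by rewrite /fpart (generator1 phi_gen). Qed.

Lemma interior_between x y : I x -> Num.min 1 x <= y <= Num.max 1 x -> I y.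
Proof.
move=> Ix; rewrite minElt maxElt => xy.
have [x1|nx1] := eqVneq x 1.
  suff -> : y = 1 by exact: generator_interior1.
  by move: xy; rewrite x1 ltxx; lra.
have t01 : 0 <= (y - x) / (1 - x) <= 1.
  move: nx1 xy; rewrite neq_lt => /orP[x1|x1].
    rewrite ltNge (ltW x1)/= => xy.
    by rewrite divr_ge0 ?ler_pdivrMr ?subr_gt0//=; lra.
  rewrite x1/= => xy; rewrite -mulrNN -invrN !opprB.
  by rewrite divr_ge0 ?ler_pdivrMr ?subr_gt0//=; lra.
have -> : y = (y - x) / (1 - x) * 1 + (1 - (y - x) / (1 - x)) * x.
  by field; rewrite subr_eq0 eq_sym.
(* Weight 0 means y = x; it is split off because [edom_interior_segment] needs a positive weight on
   the interior point. *)
have [->|t0] := eqVneq ((y - x) / (1 - x)) 0; first by rewrite mul0r subr0 add0r mul1r.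
apply: edom_interior_segment => //; first exact: (generator_convex phi_gen).
- exact: generator_interior1.
- exact: interior_subset.
- by case/andP: t01 => t1 ->; rewrite lt0r t0 t1.
Qed.

Lemma is_derive_fpart x : I x ->
  is_derive x 1 (fpart phi) ((fpart phi)^`()%classic x).
Proof. by move=> /phi_second[d1 _ _]; rewrite derive1E; exact/derivableP. Qed.

Lemma is_derive2_fpart x : I x ->
  is_derive x 1 (fpart phi)^`()%classic (second phi x).
Proof.
move=> /phi_second[_ d2 _]; rewrite /second derive1nS derive1n1 derive1E.
exact/derivableP.
Qed.

(** As phi is nonnegative and vanishes at 1, the point 1 is an interior minimum. *)
Lemma fpart_derive1 : (fpart phi)^`()%classic 1 = 0.
Proof.
have /nbhs_interior/nbhs_ballP[e /= e0 eI] := generator_nbhs1 phi_gen.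
have Ie t : t \in `](1 - e), (1 + e)[ -> I t.
  by rewrite in_itv/= => te; apply: eI; rewrite /ball/= ltr_norml; lra.
have d : is_derive (1 : R) 1 (fpart phi) 0.
  apply: (@derive1_at_min _ _ (1 - e) (1 + e)); first by lra.
  - by move=> t /Ie It; have [d _ _] := phi_second It; exact: d.
  - by rewrite in_itv/=; lra.
  - by move=> t _; rewrite fpart1 fpart_ge0.
by rewrite derive1E derive_val.
Qed.

Lemma second_gt0 : 0 < k.
Proof. by have [] := phi_second generator_interior1. Qed.

Lemma second_ge : concave_on I (fun x => (second phi x)^-1) ->
  exists s, forall x, I x -> 0 < 1 + s * (x - 1) /\
    k / (1 + s * (x - 1)) <= second phi x.
Proof.
move=> cc; have I1 : nbhs (1 : R) I by exact: nbhs_interior (generator_nbhs1 phi_gen).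
have [c Hc] := concave_on_supporting_line I1 cc; have k0 := second_gt0.
exists (c * k) => x Ix; have [_ _ x0] := phi_second Ix.
by apply: inv_affine_ge x0 k0 _; exact: Hc.
Qed.

End GeneratorBounds.

(** * Rational and affine minorants of phi, and its slope at infinity *)

Section GeneratorMinorants.
Context {R : realType}.
Variable phi : R -> \bar R.
Hypothesis phi_gen : is_generator phi.
Hypothesis phi_second : pos_second_derivative phi.
Variable s : R.
Local Notation I := (edom phi)°.
Local Notation k := (second phi 1).
Hypothesis second_lower : forall x, I x -> 0 < 1 + s * (x - 1) /\
    k / (1 + s * (x - 1)) <= second phi x.

(** Both sides vanish to first order at 1, so it is enough to compare second derivatives between 1
    and [x]. *)
Lemma fpart_ge x : I x -> 3 * k / 2 * ((x - 1) ^+ 2 / (3 + s * (x - 1))) <= fpart phi x.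
Proof.
move=> Ix; rewrite -subr_ge0.
pose H y := 3 * k / 2 * ((y - 1) ^+ 2 / (3 + s * (y - 1))).
pose dH y := 3 * k / 2 * ((6 * (y - 1) + s * (y - 1) ^+ 2) / (3 + s * (y - 1)) ^+ 2).
rewrite -[_ - _]/((fpart phi - H) x).
apply: (@ge0_second_derive _ _ ((fpart phi)^`()%classic - dH)
  (fun y => second phi y - 27 * k / (3 + s * (y - 1)) ^+ 3) 1); last 2 first.
- by rewrite !fctE fpart1// /H subrr expr0n/= mul0r mulr0 subrr.
- by rewrite !fctE fpart_derive1// /dH subrr expr0n/= !mulr0 addr0 mul0r mulr0 subrr.
move=> y /(interior_between phi_gen Ix) Iy.
have [w0 _] := second_lower Iy.
have w30 : 0 < 3 + s * (y - 1) by lra.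
have [_ ge2] := second_lower Iy.
have w3 : 3 + s * (y - 1) != 0 by rewrite gt_eqF.
split.
- by apply: is_deriveB; [exact: is_derive_fpart|exact: is_derive_sqr_over_affine].
- by apply: is_deriveB; [exact: is_derive2_fpart|exact: is_derive2_sqr_over_affine].
rewrite subr_ge0; apply: (le_trans _ ge2) => {ge2}.
rewrite ler_pdivrMr ?exprn_gt0// mulrAC ler_pdivlMr//.
rewrite [27 * k]mulrC -mulrA ler_pM2l ?second_gt0//.
(* AM-GM for 1, 1, 1 + v: 27 (1 + v) <= (3 + v)^3 *)
set v := s * (y - 1); rewrite -subr_ge0 (_ : _ - _ = v ^+ 2 * (v + 9)); last by ring.
by rewrite mulr_ge0 ?sqr_ge0//; rewrite /v; lra.
Qed.

(** With w = 3 + s u, the gap to the rational minorant, times w, is k/6 ((3 u - a w)^2 + (l^2 - a^2)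
    w^2). The square vanishes at the point of tangency; the second term is the slack that lets one
    constant l^2 serve every |a| <= l. *)
Lemma generator_interior_affine_le l a x : `|a| <= l -> I x ->
  k * a * (x - 1) - k * l ^+ 2 / 2 * (1 + s * (x - 1) / 3) <= fpart phi x.
Proof.
move=> al Ix; apply: le_trans (fpart_ge Ix).
have [w0 _] := second_lower Ix; have k0 := second_gt0 phi_gen phi_second.
move: (x - 1) k k0 w0 => u b b0 w0.
have w30 : 0 < 3 + s * u by lra.
rewrite mulrA ler_pdivlMr// -subr_ge0.
rewrite (_ : _ - _ = b / 6 * ((3 * u - a * (3 + s * u)) ^+ 2 +
  (l ^+ 2 - a ^+ 2) * (3 + s * u) ^+ 2)); last by field.
rewrite mulr_ge0 ?divr_ge0 ?(ltW b0)// addr_ge0 ?sqr_ge0// mulr_ge0 ?sqr_ge0//.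
by rewrite subr_ge0 -(real_normK (num_real a)) lerXn2r ?nnegrE// (le_trans _ al).
Qed.

(** An endpoint of the domain is reached from the interior points 1 + t (x - 1) as t tends to 1,
    where convexity bounds phi by t phi(x). *)
Lemma generator_affine_le l a x : `|a| <= l ->
  ((k * a * (x - 1) - k * l ^+ 2 / 2 * (1 + s * (x - 1) / 3))%:E <= phi x)%E.
Proof.
move=> al; have [px|] := boolP (phi x < +oo)%E; last first.
  by rewrite -leNgt leye_eq => /eqP ->; rewrite leey.
rewrite (generator_fpartK phi_gen px) lee_fin.
set L := fun u : R => k * a * u - k * l ^+ 2 / 2 * (1 + s * u / 3).
set K := k * l ^+ 2 / 2.
have k0 := ltW (second_gt0 phi_gen phi_second).
have K0 : 0 <= K by rewrite divr_ge0 ?(mulr_ge0 k0)// sqr_ge0.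
(* [L] is affine with L 0 = - K. *)
have LE t : L (t * (x - 1)) = t * L (x - 1) - (1 - t) * K by rewrite /L /K; field.
(* 1 + t (x - 1) with t < 1 is interior even when x is an endpoint of the domain. *)
have step t : 0 <= t < 1 -> t * L (x - 1) - (1 - t) * K <= t * fpart phi x.
  move=> /andP[t0 t1]; rewrite -LE.
  have t01 : 0 < 1 - t <= 1 by lra.
  have t01' : 0 <= t <= 1 by lra.
  have Iz : I (t * x + (1 - t) * 1).
    rewrite addrC -[X in _ + X * _](subKr 1 t); apply: edom_interior_segment => //.
      exact: (generator_convex phi_gen).
    exact: generator_interior1.
  have := generator_interior_affine_le al Iz.
  rewrite (_ : t * x + (1 - t) * 1 - 1 = t * (x - 1)); last by ring.
  move=> h; apply: le_trans h _.
  have := generator_convex phi_gen x 1 t01'; rewrite (generator1 phi_gen) mule0 adde0.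
  rewrite (generator_fpartK phi_gen px) (generator_fpartK phi_gen (interior_subset Iz)).
  by rewrite -EFinM lee_fin.
rewrite -[X in X <= _]/(L (x - 1)); clear LE.
move: (L (x - 1)) (fpart phi x) K K0 step => A B K' K0 step.
rewrite leNgt; apply/negP => BA.
have den : 0 < K' + (A - B) by lra.
(* A single [t] replaces the limit: [step] says t (K' + (A - B)) <= K', and the chosen [t], midway
   between K' / (K' + (A - B)) and 1, makes the left side K' + (A - B) / 2. *)
have t01 : 0 <= (K' + (A - B) / 2) / (K' + (A - B)) < 1.
  by rewrite divr_ge0 ?ltr_pdivrMr//=; lra.
have e : (K' + (A - B) / 2) / (K' + (A - B)) * (K' + (A - B)) = K' + (A - B) / 2.
  by rewrite divfK ?gt_eqF.
by have := step _ t01; move: e; set t := (_ / _); lra.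
Qed.

(** The quotient phi(x) / x is nondecreasing on [1, +oo), so the [lim] in [slope_infty] is a true
    limit, equal to the supremum. A supremum below [c] would contradict the affine minorant at large
    x. *)
Lemma slope_infty_ge (c b : R) : (forall x : R, ((c * x - b)%:E <= phi x)%E) ->
  (c%:E <= slope_infty phi)%E.
Proof.
(* Truncation at 1 makes the quotient monotone on the whole line. *)
move=> cb; pose f (x : R) := (phi (Num.max 1 x)%R * ((Num.max 1 x)^-1)%:E)%E.
have ndf : {homo f : x y / x <= y >-> (x <= y)%E}.
  suff h (u v : R) : 1 <= u -> u <= v -> (phi u * (u^-1)%:E <= phi v * (v^-1)%:E)%E.
    move=> x y xy; apply: h; first by rewrite le_max lexx.
    by rewrite ge_max !le_max lexx xy orbT.
  move=> u1 uv; have u0 : 0 < u by lra.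
  have v0 : 0 < v by lra.
  have v1 : 1 <= v by lra.
  have [u1e|nu1] := eqVneq u 1.
    rewrite u1e (generator1 phi_gen) mul0e mule_ge0 ?(generator_ge0 phi_gen)//.
    by rewrite lee_fin invr_ge0 ltW.
  have v1' : 0 < v - 1 by move: nu1; rewrite neq_lt; lra.
  (* Since phi(1) = 0, writing [u] as a combination of [v] and 1 gives phi u <= (u - 1) / (v - 1)
     phi v, and (u - 1) / (v - 1) <= u / v. *)
  have t01 : 0 <= (u - 1) / (v - 1) <= 1.
    by rewrite divr_ge0 ?ler_pdivrMr//=; lra.
  have := generator_convex phi_gen v 1 t01; rewrite (generator1 phi_gen) mule0 adde0.
  rewrite (_ : _ * v + _ = u); last by field; rewrite gt_eqF.
  move=> h; rewrite lee_pdivrMr// muleAC; apply: le_trans h _.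
  rewrite muleC -muleA; apply: lee_wpmul2l; first exact: (generator_ge0 phi_gen).
  rewrite -EFinM lee_fin ler_pdivrMr// mulrAC ler_pdivlMr//; lra.
have cvf := nondecreasing_cvge ndf.
have -> : slope_infty phi = ereal_sup (range f).
  apply/cvg_lim => //; apply: cvg_trans cvf; apply: near_eq_cvg.
  by near=> x; rewrite /f max_r.
have sup_ge (x : R) : 1 <= x -> (phi x <= ereal_sup (range f) * x%:E)%E.
  move=> x1; rewrite -lee_pdivrMr; last by lra.
  by apply: ereal_sup_ubound; exists x => //; rewrite /f max_r.
case: (ereal_sup _) sup_ge => [M| |] sup_ge; rewrite ?leey//.
  rewrite lee_fin leNgt; apply/negP => Mc.
  (* The minorant and [sup_ge] force (c - M) x <= b, which fails once x >= (b + 1) / (c - M). *)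
  have := le_trans (cb _) (sup_ge (Num.max 1 ((b + 1) / (c - M))) _).
  rewrite le_max lexx -EFinM lee_fin => /(_ isT).
  have : (b + 1) / (c - M) <= Num.max 1 ((b + 1) / (c - M)) by rewrite le_max lexx orbT.
  by rewrite ler_pdivrMr ?subr_gt0//; lra.
by have := le_trans (cb _) (sup_ge 1 (lexx _)); rewrite mule1.
Unshelve. all: by end_near. Qed.

End GeneratorMinorants.

(** * Sublevel sets of the conjugate and the height bound *)

Section Height.
Context {R : realType}.
Variable phi : R -> \bar R.
Hypothesis phi_gen : is_generator phi.

(** One point 1 + e / 2 of the domain bounds the conjugate below by a line of positive slope e /
    2. *)
Lemma psi_star_cvg_pinfty : psi_star phi x @[x --> +oo%R] --> +oo%E.
Proof.
have /nbhs_ballP[e /= e0 ep] := generator_nbhs1 phi_gen.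
have e2 : 0 < e / 2 by rewrite divr_gt0.
have pe : edom phi (e / 2 + 1).
  by apply: ep; rewrite /ball/= opprD addrCA subrr addr0 normrN gtr0_norm//; lra.
have ge x : ((e / 2 * x - fpart phi (e / 2 + 1))%:E <= psi_star phi x)%E.
  apply: ereal_sup_ubound; exists (e / 2) => //.
  by rewrite /shift1 (generator_fpartK phi_gen pe).
apply/cvgeyPge => A; near=> x; apply: le_trans (ge x).
by rewrite lee_fin lerBrDr -ler_pdivrMl.
Unshelve. all: by end_near. Qed.

(** Each affine function in the supremum is monotone, so between [y] and [z] it is at most its value
    at one of them, chosen by the sign of [u]. This supplies measurability of the sublevel sets. *)
Lemma psi_star_sublevel_interval (h : \bar R) :
  is_interval [set y : R | (psi_star phi y <= h)%E].
Proof.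
move=> y z /= yh zh x /andP[yx xz]; apply: ge_ereal_sup => _ [u _ <-].
have [u0|/ltW u0] := leP 0 u.
  apply: (le_trans _ zh); apply: le_trans (ereal_sup_ubound _); last by exists u.
  by rewrite leeB// lee_fin ler_wpM2l.
apply: (le_trans _ yh); apply: le_trans (ereal_sup_ubound _); last by exists u.
by rewrite leeB// lee_fin ler_wnM2l.
Qed.

Lemma height_for_width_le (k s t : R) : 0 < k -> 0 <= t ->
  (forall l a x : R, `|a| <= l ->
    ((k * a * (x - 1) - k * l ^+ 2 / 2 * (1 + s * (x - 1) / 3))%:E <= phi x)%E) ->
  (height_for_width (psi_star phi) t <= (t ^+ 2 / (8 * k))%:E)%E.
Proof.
move=> k0 t0 affine_le; apply: ereal_inf_lbound; split.
  by rewrite lee_fin divr_ge0 ?sqr_ge0// mulr_ge0// ltW.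
(* The minorants have slopes k a + c with |a| <= l: an interval of centre [c] and length 2 k l = t.
   The height k l^2 / 2 is then t^2 / (8 k). *)
pose l := t / (2 * k); pose c := - (k * l ^+ 2 * s / 6).
have kl : k * l = t / 2 by rewrite /l; field; rewrite gt_eqF.
have sub : `[c - t / 2, c + t / 2] `<=`
    [set y | (psi_star phi y <= (t ^+ 2 / (8 * k))%:E)%E].
  move=> y /=; rewrite in_itv/= => yc; apply: ge_ereal_sup => _ [u _ <-].
  have al : `|(y - c) / k| <= l.
    rewrite normrM normfV (gtr0_norm k0) ler_pdivrMr// mulrC kl ler_norml; lra.
  have := affine_le _ _ (u + 1) al; rewrite addrK => le_phi.
  rewrite /shift1; case: (phi (u + 1)) le_phi => [r| |] //=; last by rewrite addeNy leNye.
  (* For a = (y - c) / k the minorant has slope exactly [y], so its difference with u y is constant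
     in [u]. *)
  rewrite -EFinB !lee_fin => le_phi; suff -> : t ^+ 2 / (8 * k) =
      u * y - (k * ((y - c) / k) * u - k * l ^+ 2 / 2 * (1 + s * u / 3)) by rewrite lerD2l lerN2.
  rewrite (_ : t = 2 * (k * l)); last by rewrite kl; field.
  by rewrite /c; field; rewrite gt_eqF.
apply: (@le_trans _ _ (lebesgue_measure (`[c - t / 2, c + t / 2]%classic : set R))).
  rewrite lebesgue_measure_itv/= lte_fin; case: ifPn => [_|].
    by rewrite -EFinB lee_fin; lra.
  by rewrite -leNgt lee_fin; lra.
apply: (le_measure lebesgue_measure _ _ sub); rewrite inE//.
by apply: is_interval_measurable; exact: psi_star_sublevel_interval.
Qed.

End Height.

(** * Integrating the minorants: from test functions to total variation *)

Section DivergenceBound.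
Local Open Scope charge_scope.
Context {d : measure_display} {T : measurableType d} {R : realType}.

Lemma bounded_in (A : set T) (f : T -> R) (M : R) : (forall x, `|f x| <= M) ->
  [bounded f x | x in A].
Proof.
move=> fM; exists M; split; first exact: num_real.
by move=> N MN x _; exact: le_trans (fM x) (ltW MN).
Qed.

Lemma finite_measure_bounded_integrable (m : {finite_measure set T -> \bar R})
    (f : T -> R) (M : R) : measurable_fun setT f -> (forall x, `|f x| <= M) ->
  m.-integrable setT (EFin \o f).
Proof.
move=> mf fM; apply: measurable_bounded_integrable => //.
  by rewrite ltey_eq fin_num_measure.
exact: bounded_in fM.
Qed.

(** The pointwise bound is taken at y = q x, with q the density of [m], and integrated against [nu];
    the change of variables turns the integral of a q into that of [a] against [m]. *)
Lemma density_affine_integral_le (m nu : {finite_measure set T -> \bar R})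
    (F : R -> \bar R) (a b : T -> R) (M : R) :
  m `<< nu -> (forall x, 0 <= F x)%E -> measurable_fun setT F ->
  measurable_fun setT a -> measurable_fun setT b ->
  (forall x, `|a x| <= M) -> (forall x, `|b x| <= M) ->
  (forall x y, ((a x * y + b x)%:E <= F y)%E) ->
  ((\int[m]_x a x + \int[nu]_x b x)%:E <=
    \int[nu]_x F (fine (('d (charge_of_finite_measure m) '/d nu) x)))%E.
Proof.
move=> mnu F0 mF ma mb aM bM abF.
set q := 'd _ '/d _.
have qi : nu.-integrable setT q by exact: Radon_Nikodym_integrable.
have qf x : q x \is a fin_num by exact: Radon_Nikodym_fin_num.
have ai := @finite_measure_bounded_integrable m _ _ ma aM.
have bi := @finite_measure_bounded_integrable nu _ _ mb bM.
have aqi : nu.-integrable setT ((EFin \o a) \* q)%E.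
  by apply: integrableMr => //; exact: bounded_in aM.
have mFq : measurable_fun setT (fun x => F (fine (q x))).
  apply: measurableT_comp => //; apply: measurableT_comp => //.
  exact: measurable_int qi.
have -> : ((\int[m]_x a x + \int[nu]_x b x)%:E =
    \int[nu]_x (((EFin \o a) \* q) x + (b x)%:E))%E.
  rewrite integralD// (Radon_Nikodym_change_of_variables mnu)//.
  by rewrite EFinD /Rintegral !fineK//; exact: integrable_fin_num.
(* An infinite right side is trivial; a finite one makes the nonnegative integrand integrable, as
   the comparison of integrals requires. *)
have [Foo|] := boolP (\int[nu]_x F (fine (q x)) < +oo)%E; last first.
  by rewrite -leNgt leye_eq => /eqP ->; rewrite leey.
apply: le_integral => //; first exact: integrableD.
  apply/integrableP; split=> //.
  by under eq_integral do rewrite gee0_abs//.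
by move=> x _; rewrite -(fineK (qf x))/= -EFinM -EFinD.
Qed.

Lemma Rintegral_lebesgue_decomposition (mu nu m1 m2 : {finite_measure set T -> \bar R})
  (f : T -> R) (M : R) : is_lebesgue_decomposition mu nu m1 m2 ->
  measurable_fun setT f -> (forall x, `|f x| <= M) ->
  \int[mu]_x f x = \int[m1]_x f x + \int[m2]_x f x.
Proof.
move=> [muE _ _] mf fM; rewrite /Rintegral (eq_measure_integral (measure_add m1 m2)).
  rewrite integral_measure_add//; try exact: finite_measure_bounded_integrable fM.
  by rewrite fineD//; apply: integrable_fin_num => //; exact: finite_measure_bounded_integrable fM.
by move=> A mA _; exact: etrans (muE A mA) (esym (measure_addE m1 m2 A)).
Qed.

Variable phi : R -> \bar R.
Hypothesis phi_gen : is_generator phi.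
Variables k s : R.
Hypothesis k0 : 0 < k.
Hypothesis affine_le : forall l a x : R, `|a| <= l ->
  ((k * a * (x - 1) - k * l ^+ 2 / 2 * (1 + s * (x - 1) / 3))%:E <= phi x)%E.

Lemma phi_divergence_ge_test (mu nu : probability T R) (g : T -> R) l :
  measurable_fun setT g -> (forall x, -1 <= g x <= 1) -> 0 <= l ->
  ((k * l * (\int[mu]_x g x - \int[nu]_x g x) - k * l ^+ 2 / 2)%:E
    <= phi_divergence phi mu nu)%E.
Proof.
move=> mg g1 l0; rewrite /phi_divergence.
have := ac_sing_partP mu nu; set m1 := ac_part mu nu; set m2 := sing_part mu nu => dec.
have [muE m1nu _] := dec.
(* The minorant with parameter l g(x), expanded as a polynomial in y, has slope [a x] and constant
   term [b x]; [e] is the share of [s] in both. *)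
pose e := k * l ^+ 2 * s / 6.
pose a x := k * l * g x - e; pose b x := - (k * l * g x) + (e - k * l ^+ 2 / 2).
have kl0 : 0 <= k * l by rewrite mulr_ge0// ltW.
have gn x : `|g x| <= 1 by rewrite ler_norml.
have gkl x : `|k * l * g x| <= k * l by rewrite normrM (ger0_norm kl0) ler_piMr.
have aM x : `|a x| <= k * l + (`|e| + `|e - k * l ^+ 2 / 2|).
  by rewrite (le_trans (ler_normB _ _))// lerD// ler_wpDr.
have bM x : `|b x| <= k * l + (`|e| + `|e - k * l ^+ 2 / 2|).
  by rewrite (le_trans (ler_normD _ _))// normrN lerD// ler_wpDl.
have ma : measurable_fun setT a by apply: measurable_funB => //; exact: measurable_funM.
have mb : measurable_fun setT b.
  by apply: measurable_funD => //; apply: measurable_funN; exact: measurable_funM.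
have ab x y : ((a x * y + b x)%:E <= phi y)%E.
  have gl : `|l * g x| <= l by rewrite normrM (ger0_norm l0) ler_piMr.
  apply: le_trans (affine_le y gl); rewrite lee_fin /a /b /e le_eqVlt; apply/orP; left.
  by apply/eqP; field.
have mphi : measurable_fun setT phi.
  by apply: lower_semicontinuous_measurable; exact: (generator_lsc phi_gen).
have ac_ge := density_affine_integral_le m1nu (generator_ge0 phi_gen) mphi ma mb aM bM ab.
(* The parameter [l] itself gives the largest slope; it pays for the singular part, where g <= 1. *)
have slope_ge : ((k * l - e)%:E <= slope_infty phi)%E.
  apply: (slope_infty_ge phi_gen (b := k * l + (k * l ^+ 2 / 2 - e))) => x.
  have ll : `|l| <= l by rewrite ger0_norm.
  apply: le_trans (affine_le x ll); rewrite lee_fin /e le_eqVlt; apply/orP; left.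
  by apply/eqP; field.
apply: le_trans (leeD ac_ge (lee_wpmul2l (measure_ge0 m2 setT) slope_ge)).
have m2f : m2 setT \is a fin_num by exact: fin_num_measure.
have m1f : m1 setT \is a fin_num by exact: fin_num_measure.
rewrite -[X in (_ + X * _)%E](fineK m2f) -EFinM -EFinD lee_fin.
have gi (m : {finite_measure set T -> \bar R}) : m.-integrable setT (EFin \o g).
  exact: finite_measure_bounded_integrable gn.
have ci (m : {finite_measure set T -> \bar R}) c : m.-integrable setT (EFin \o cst c).
  exact: finite_measure_integrable_cst.
have gki (m : {finite_measure set T -> \bar R}) :
    m.-integrable setT (EFin \o (fun x => k * l * g x)).
  by apply: (@finite_measure_bounded_integrable m _ (k * l)) => //; exact: measurable_funM.
have Zl (m : {finite_measure set T -> \bar R}) :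
    \int[m]_x (k * l * g x) = k * l * \int[m]_x g x := RintegralZl (k * l) measurableT (gi m).
have Ea : \int[m1]_x a x = k * l * \int[m1]_x g x - e * fine (m1 setT).
  by rewrite RintegralB// ?Zl ?Rintegral_cst//; [exact: gki|exact: ci].
have Eb : \int[nu]_x b x = e - k * l ^+ 2 / 2 - k * l * \int[nu]_x g x.
  rewrite (_ : b = fun x => e - k * l ^+ 2 / 2 - k * l * g x); last first.
    by apply/funext => x; rewrite /b addrC.
  rewrite RintegralB//; [|exact: ci|exact: gki].
  have nu1 : fine (nu setT) = 1 := congr1 fine (probability_setT nu).
  rewrite Rintegral_cst// -[X in _ = X - _]mulr1; congr (_ * _ - _); first exact: nu1.
  exact: Zl.
rewrite [X in _ <= X + _ + _]Ea [X in _ <= _ + X + _]Eb.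
have Emu := Rintegral_lebesgue_decomposition dec mg gn.
rewrite [X in k * l * (X - _)]Emu.
(* The terms in [e] sum to e (1 - m1(T) - m2(T)) = 0. *)
have mass : fine (m1 setT) + fine (m2 setT) = 1.
  rewrite -fineD// (_ : (_ + _)%E = 1%E)//.
  exact: etrans (esym (muE _ measurableT)) (probability_setT mu).
have gm2 : \int[m2]_x g x <= fine (m2 setT).
  rewrite -[leRHS]mul1r -(Rintegral_cst _ measurableT); apply: le_Rintegral => //.
  - exact: gi.
  - exact: ci.
  - by move=> x _; have /andP[] := g1 x.
have := ler_wpM2l kl0 gm2.
have -> : fine (m1 setT) = 1 - fine (m2 setT) by rewrite -mass addrK.
by rewrite -/m2; nra.
Qed.

(** For a test difference z >= 0, the choice l = z maximises k l z - k l^2 / 2, with value k z^2 /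
    2. *)
Lemma phi_divergence_ge_TV (mu nu : probability T R) :
  ((k / 2 * TV_distance mu nu ^+ 2)%:E <= phi_divergence phi mu nu)%E.
Proof.
have [Doo|] := boolP (phi_divergence phi mu nu < +oo)%E; last first.
  by rewrite -leNgt leye_eq => /eqP ->; rewrite leey.
set D := phi_divergence phi mu nu.
pose S := [set `| \int[mu]_x g x - \int[nu]_x g x | | g in
    [set g : T -> R | measurable_fun setT g /\ forall x, (-1 <= g x <= 1)%R]].
have S_ge z : S z -> ((k * z ^+ 2 / 2)%:E <= D)%E.
  move=> [g [mg g1] zE]; have z0 : 0 <= z by rewrite -zE.
  (* The absolute value is removed by testing with [g] or with its opposite. *)
  have sgn (h : T -> R) : measurable_fun setT h -> (forall x, -1 <= h x <= 1) ->
      \int[mu]_x h x - \int[nu]_x h x = z -> ((k * z ^+ 2 / 2)%:E <= D)%E.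
    move=> mh h1 hz; apply: le_trans (phi_divergence_ge_test mu nu mh h1 z0).
    by rewrite hz lee_fin le_eqVlt; apply/orP; left; apply/eqP; field.
  have gi (m : probability T R) : m.-integrable setT (EFin \o g).
    by apply: (@finite_measure_bounded_integrable m _ 1) => // x; rewrite ler_norml.
  have [p|n] := leP 0 (\int[mu]_x g x - \int[nu]_x g x).
    by apply: (sgn g mg g1); rewrite -zE ger0_norm.
  apply: (sgn (fun x => -1 * g x)).
  - exact: measurable_funM.
  - by move=> x; have := g1 x; lra.
  - rewrite (RintegralZl (-1) measurableT (gi mu)) (RintegralZl (-1) measurableT (gi nu)).
    by rewrite -zE ltr0_norm//; lra.
have S0 : S 0.
  exists (cst 0) => /=; last by rewrite !Rintegral_cst// !mul0r subrr normr0.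
  by split=> // x; lra.
have D0 : (0 <= D)%E by have := S_ge _ S0; rewrite expr0n/= mulr0 mul0r.
have Df : D \is a fin_num by rewrite ge0_fin_numE.
(* Solving k z^2 / 2 <= D for z gives a real upper bound, which passes to the supremum before
   squaring back. *)
have Sle : ubound S (Num.sqrt (2 / k * fine D)).
  move=> z Sz; have := S_ge _ Sz; rewrite -(fineK Df) lee_fin => zD.
  have z0 : 0 <= z by case: Sz => g _ <-.
  rewrite -(ger0_norm z0) -sqrtr_sqr ler_wsqrtr// mulrAC ler_pdivlMr//; lra.
have TV_le : TV_distance mu nu <= Num.sqrt (2 / k * fine D).
  by apply: ge_sup => //; exists 0.
have TV_ge0 : 0 <= TV_distance mu nu.
  by apply: ub_le_sup => //; exists (Num.sqrt (2 / k * fine D)).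
rewrite -(fineK Df) lee_fin mulrC -ler_pdivlMr ?divr_gt0//.
rewrite (_ : _ / (k / 2) = 2 / k * fine D); last by field; rewrite gt_eqF.
rewrite -[leRHS]sqr_sqrtr ?mulr_ge0 ?fine_ge0 ?invr_ge0 ?(ltW k0)//.
by rewrite lerXn2r ?nnegrE ?sqrtr_ge0.
Qed.

End DivergenceBound.

(** * Both inequalities from one family of minorants *)

Local Open Scope ereal_scope.

Theorem corollary6p3p18 (R : realType) (d : measure_display)
    (T : measurableType d)
    (T_nontrivial : exists A : set T, [/\ measurable A, A <> set0 & A <> setT])
    (phi : R -> \bar R)
    (phi_gen : is_generator phi)
    (phi_strict : strict_econvex phi)
    (phi_second : pos_second_derivative phi)
    (phi_concave : concave_on (edom phi)° (fun x => (second phi x)^-1)%R) :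
  (slope_infty phi = +oo ->
    psi_star phi x @[x --> left_of (slope_infty phi)] --> +oo) /\
  (psi_star phi x @[x --> left_of (slope_infty phi)] --> +oo ->
    (forall t : R, (0 <= t)%R ->
      height_for_width (psi_star phi) t <= (t ^+ 2 / (8 * second phi 1))%:E) /\
    (forall mu nu : probability T R,
      (second phi 1 / 2 * TV_distance mu nu ^+ 2)%:E
        <= phi_divergence phi mu nu)).
Proof.
split=> [->|_]; first by rewrite left_of_pinfty; exact: psi_star_cvg_pinfty.
have [s second_lower] := second_ge phi_gen phi_second phi_concave.
have affine_le := generator_affine_le phi_gen phi_second second_lower.
have k0 := second_gt0 phi_gen phi_second.
split=> [t t0|mu nu]; first exact: height_for_width_le affine_le.
exact: phi_divergence_ge_TV affine_le mu nu.
Qed.
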